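(* For every $\beta\in(0,1]$ there exists $\alpha_0>0$ such that for every $\alpha\in(0,\alpha_0]$ there exist $\mu_0>0$ and $n_0$ such that the following holds for all $\mu\in(0,\mu_0]$ and $n\ge n_0$. Let $G$ be a graph on $n$ vertices and $\chi$ a $\mu n$-bounded colouring of $E(G)$. Let $Z\subseteq E(G)$ with $|Z|\le \alpha n$ such that for each $f\in Z$, the colour $\chi(f)$ appears on no edge of $E(G)$ other than $f$. Suppose that $G$ has at least one Hamilton cycle containing $Z$, and suppose that for every directed Hamilton cycle $\vec H$ of $G$ with $Z\subseteq E(H)$ and every edge $e\in E(H)\setminus Z$, there are at least $\beta n^2$ pairs $(e',i)$ with $e'\in E(G)\setminus E(H)$ and $i\in\{1,2\}$ such that the switching $s_i(\vec H;e,e')$ is admissible. Then $G$ has a rainbow Hamilton cycle that contains $Z$.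
   Context: An edge-colouring is $k$-bounded if no colour appears on more than $k$ edges; a subgraph is rainbow if its edges have pairwise distinct colours. A directed Hamilton cycle $\vec H$ of $G$ is a Hamilton cycle $H$ of $G$ with its edges oriented cyclically so every vertex has out-degree one; its successor function $\pi:V(G)\to V(G)$ sends $x$ to the head of the arc leaving $x$. Switchings: given $\vec H$ with successor function $\pi$, an edge $e=x\pi(x)\in E(H)$, and an edge $e'=x'y'\notin E(H)$ whose endpoints are labelled so that $x$ lies on the directed path of $\vec H$ from $y'$ to $x'$, let $H_1=(H-\{e,\,x'\pi(x'),\,\pi^{-1}(y')y'\})+\{e',\,x\pi(x'),\,\pi^{-1}(y')\pi(x)\}$ and $H_2=(H-\{e,\,x'\pi(x'),\,\pi^{-1}(y')y'\})+\{e',\,x\pi^{-1}(y'),\,\pi(x)\pi(x')\}$. Each $H_i$ is a Hamilton cycle on $V(G)$ (not necessarily in $G$), and $s_i(\vec H;e,e')$ denotes $H_i$ with the cyclic orientation containing the arc $(x',y')$. The switching $s_i(\vec H;e,e')$ is admissible if $H_i$ is a subgraph of $G$. *)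

(* Defs.v *)
From mathcomp Require Import all_boot fingroup perm.
Set Implicit Arguments. Unset Strict Implicit. Unset Printing Implicit Defensive.

Definition is_graph (n : nat) (G : {set {set 'I_n}}) : Prop :=
  forall e, e \in G -> #|e| = 2.

(* A directed Hamilton cycle on 'I_n is given by its successor function pi,
   a permutation whose single orbit is all of 'I_n (and n >= 3). *)
Definition dir_ham_cycle_on (n : nat) (pi : {perm 'I_n}) : Prop :=
  3 <= n /\ forall x y : 'I_n, fconnect pi x y.

Definition hedges (n : nat) (pi : {perm 'I_n}) : {set {set 'I_n}} :=
  [set [set x; pi x] | x : 'I_n].

Definition dir_ham_cycle (n : nat) (G : {set {set 'I_n}}) (pi : {perm 'I_n}) : Prop :=
  dir_ham_cycle_on pi /\ hedges pi \subset G.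

Definition on_path (n : nat) (pi : {perm 'I_n}) (y' x' x : 'I_n) : bool :=
  x \in traject pi y' (findex pi y' x').+1.

(* The two switched edge sets H_1, H_2 for e = x pi(x) and e' = x'y'. *)
Definition switch1 (n : nat) (pi : {perm 'I_n}) (x x' y' : 'I_n) : {set {set 'I_n}} :=
  (hedges pi :\: [set [set x; pi x]; [set x'; pi x']; [set (pi^-1)%g y'; y']])
  :|: [set [set x'; y']; [set x; pi x']; [set (pi^-1)%g y'; pi x]].

Definition switch2 (n : nat) (pi : {perm 'I_n}) (x x' y' : 'I_n) : {set {set 'I_n}} :=
  (hedges pi :\: [set [set x; pi x]; [set x'; pi x']; [set (pi^-1)%g y'; y']])
  :|: [set [set x'; y']; [set x; (pi^-1)%g y']; [set pi x; pi x']].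

Definition switch (n : nat) (pi : {perm 'I_n}) (i : 'I_2) (x x' y' : 'I_n) :=
  if val i == 0 then switch1 pi x x' y' else switch2 pi x x' y'.

(* The switching s_i(H; e, e') with e = x pi(x) is admissible: for the
   (unique) labelling e' = x'y' with x <> x' and x on the directed path from
   y' to x', the edge set H_i lies in G.  (Index i : 'I_2 encodes i = 1, 2.) *)
Definition admissible (n : nat) (G : {set {set 'I_n}}) (pi : {perm 'I_n})
    (x : 'I_n) (e' : {set 'I_n}) (i : 'I_2) : bool :=
  [exists x' : 'I_n, exists y' : 'I_n,
     [&& e' == [set x'; y'], x' != x, on_path pi y' x' x &
         switch pi i x x' y' \subset G]].

Definition n_admissible (n : nat) (G : {set {set 'I_n}}) (pi : {perm 'I_n}) (x : 'I_n) : nat :=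
  #|[set p : {set 'I_n} * 'I_2 |
      [&& p.1 \in G, p.1 \notin hedges pi & admissible G pi x p.1 p.2]]|.

Definition colour_class (n : nat) (G : {set {set 'I_n}}) (chi : {set 'I_n} -> nat) (c : nat) :=
  [set f in G | chi f == c].

Definition rainbow (n : nat) (chi : {set 'I_n} -> nat) (H : {set {set 'I_n}}) : Prop :=
  {in H &, injective chi}.

(* Main.v *)
Require Import Defs.
From mathcomp Require Import all_boot fingroup perm.
From mathcomp Require Import zify.
From Stdlib Require Import Reals Lra.
Set Implicit Arguments. Unset Strict Implicit. Unset Printing Implicit Defensive.

(* The lopsided local lemma is applied to the uniformly random directed Hamilton
   cycle of G through Z, the bad events being that two edges e, f of equal colour
   both lie on it; events sharing no vertex are treated as independent, so the
   dependency degree is O(mu n^2) and each bad event must have conditional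
   probability O(1/n^2).  Conditionally on avoiding events that do not touch e,
   consider switchings s_i(H; e, e') that keep Z (and f).  Of the beta n^2
   admissible ones, O(alpha n^2) have e' touching a protected edge and at most
   2 mu n^2 have e' of a colour present on H; the remaining ones create no new
   conditioned event, because every new edge other than e' touches e.  A cycle
   arises from at most 4n switchings removing e, so the presence of e costs a factor
   O(1/n), and switching e and then f away gives O(1/n^2). *)

(** * Counting tools *)

Lemma card_le_rel (T U : finType) (A : {set T}) (B : {set U}) (R : T -> U -> Prop) :
  (forall t, t \in A -> exists2 u, u \in B & R t u) ->
  (forall t t' u, R t u -> R t' u -> t = t') -> #|A| <= #|B|.
Proof.
move=> total inj.
have [->|[t0 t0A]] := set_0Vmem A; first by rewrite cards0.
have [u0 _ _] := total t0 t0A.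
(* Choosing one related element for each [t] gives a map that is injective on [A]; [u0] only fills
   in its values outside [A]. *)
have [f fP] : exists f : T -> U, forall t, t \in A -> f t \in B /\ R t (f t).
  apply: (fin_all_exists (P := fun t u => t \in A -> u \in B /\ R t u)) => t.
  by have [/total[u uB Rtu]|] := boolP (t \in A); [exists u | exists u0].
rewrite -(card_in_imset (f := f)) => [|t t' tA t'A eq_f].
  by apply/subset_leq_card/subsetP=> _ /imsetP[t tA ->]; case: (fP t tA).
by apply: (inj _ _ (f t)); [case: (fP t tA) | rewrite eq_f; case: (fP t' t'A)].
Qed.

Lemma card_bigcup (T I : finType) (P : {set I}) (F : I -> {set T}) :
  #|\bigcup_(i in P) F i| <= \sum_(i in P) #|F i|.
Proof.
elim/big_rec2: _ => [|i k B _ leB]; first by rewrite cards0.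
by rewrite (leq_trans (leq_card_setU _ _)) // leq_add2l.
Qed.

(** * Avoiding families of events, and the local lemma *)

Definition avoiding (T I : finType) (A : I -> {set T}) (Om : {set T}) (S : {set I}) :=
  Om :\: \bigcup_(j in S) A j.

Lemma avoidingP (T I : finType) (A : I -> {set T}) (Om : {set T}) (S : {set I}) w :
  reflect (w \in Om /\ forall j, j \in S -> w \notin A j) (w \in avoiding A Om S).
Proof.
rewrite in_setD andbC; apply: (iffP andP) => -[wOm].
  move=> wA; split=> // j jS; apply: contra wA => wA.
  by apply/bigcupP; exists j.
by move=> wA; split=> //; apply/bigcupP=> -[j /wA/negP].
Qed.

(* The symmetric lopsided Lovasz local lemma for counting measure, with p = 1 / M. *)
Section LopsidedLocalLemma.
Variables (T I : finType) (Om : {set T}) (J : {set I}) (A : I -> {set T}).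
Variables (N : I -> {set I}) (M d : nat).
Local Notation av := (avoiding A Om).
Hypothesis degN : forall i, i \in J -> #|J :&: N i| <= d.
Hypothesis dM : 4 * d <= M.
Hypothesis lopsided : forall i (S : {set I}), i \in J -> S \subset J ->
  [disjoint S & N i] -> M * #|A i :&: av S| <= #|av S|.

Lemma avoidingU (S S' : {set I}) : av (S :|: S') = av S :\: \bigcup_(j in S') A j.
Proof.
apply/setP=> w; apply/avoidingP/setDP.
  move=> [wOm wA]; split; first by apply/avoidingP; split=> // j jS; rewrite wA ?inE ?jS.
  by apply/bigcupP=> -[j jS']; apply/negP; rewrite wA ?inE ?jS' ?orbT.
move=> [/avoidingP[wOm wA] wA']; split=> // j /setUP[/wA//|jS'].
by apply: contra wA' => wAj; apply/bigcupP; exists j.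
Qed.

Lemma avoidingS (S S' : {set I}) : S \subset S' -> av S' \subset av S.
Proof. by move=> /setUidPr <-; rewrite avoidingU subsetDl. Qed.

(** Split [S] into the neighbours [S1] of [i] and the rest [S2]. Lopsidedness bounds [A i] inside
    [av S2], and by induction avoiding [S1] as well loses at most half of [av S2]; hence the factor
    2. *)
Lemma lll_conditional i (S : {set I}) : i \in J -> S \subset J -> M * #|A i :&: av S| <= 2 * #|av S|.
Proof.
have [k] := ubnP #|S|; elim: k => // k IHk in i S * => ltSk iJ SJ.
set S1 := S :&: N i; set S2 := S :\: N i.
have S2J : S2 \subset J by rewrite (subset_trans (subsetDl _ _)).
have disS2 : [disjoint S2 & N i] by rewrite disjoint_sym disjoints_subset setCD subsetUr.
have leS2 : M * #|A i :&: av S| <= #|av S2|.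
  apply: leq_trans (lopsided iJ S2J disS2); rewrite leq_mul2l subset_leq_card ?orbT //.
  by rewrite setIS // avoidingS // subsetDl.
apply: leq_trans leS2 _.
have [S10|[j0 j0S1]] := set_0Vmem S1.
  by rewrite -(setID S (N i)) -/S1 S10 set0U leq_pmull.
have ltS2 : #|S2| < k.
  apply: leq_trans _ (ltnSE ltSk); apply/proper_card/properP; split; first exact: subsetDl.
  by exists j0; case/setIP: j0S1 => // jS jN; rewrite inE jN.
have S1d : #|S1| <= d by apply: leq_trans (degN iJ); rewrite subset_leq_card // setSI.
(* By induction each of the at most [d] events of [S1] takes at most a share 2/M of [av S2]. *)
have loss : M * #|av S2 :&: \bigcup_(j in S1) A j| <= d * (2 * #|av S2|).
  apply: leq_trans (_ : M * (\sum_(j in S1) #|A j :&: av S2|) <= _).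
    by rewrite leq_mul2l setIC big_distrl card_bigcup orbT.
  rewrite big_distrr /=; apply: (leq_trans (n := \sum_(j in S1) 2 * #|av S2|)).
    apply: leq_sum => j jS1; apply: IHk => //; apply: (subsetP SJ).
    by case/setIP: jS1.
  by rewrite sum_nat_const leq_mul2r S1d orbT.
have avS : av S = av S2 :\: \bigcup_(j in S1) A j.
  by rewrite -avoidingU setUC setID.
have := cardsID (\bigcup_(j in S1) A j) (av S2); rewrite -avS.
move: loss; set a := #|av S2|; set b := #|_ :&: _|; set c := #|av S| => loss eqa.
have d_gt0 : 0 < d by apply: leq_trans S1d; apply/card_gt0P; exists j0.
suff: 2 * b <= a by lia.
have: 4 * d * b <= d * (2 * a) by apply: leq_trans loss; rewrite leq_mul2r dM orbT.
have -> : 4 * d * b = d * 2 * (2 * b) by lia.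
by rewrite (mulnA d 2 a) leq_pmul2l // muln_gt0 d_gt0.
Qed.

(** Events are added one at a time; each takes at most a share 2/M < 1 of what is left, so something
    always remains. *)
Lemma lopsided_local_lemma : 2 < M -> Om != set0 -> exists2 w, w \in Om & forall i, i \in J -> w \notin A i.
Proof.
move=> M2 Om0.
suff: forall S : {set I}, S \subset J -> av S != set0.
  by move=> /(_ J (subxx _))/set0Pn[w /avoidingP[wOm wA]]; exists w.
move=> S; have [k] := ubnP #|S|; elim: k => // k IHk in S * => ltSk SJ.
have [->|[i iS]] := set_0Vmem S.
  have /set0Pn[w wOm] := Om0; apply/set0Pn; exists w; apply/avoidingP; split=> // j.
  by rewrite inE.
have SiJ : S :\ i \subset J by rewrite (subset_trans (subsetDl _ _)).
have ltSi : #|S :\ i| < k by rewrite (cardsD1 i S) iS add1n in ltSk.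
have := IHk _ ltSi SiJ; rewrite -card_gt0 => av_gt0.
have := lll_conditional (subsetP SJ i iS) SiJ.
rewrite -[in av S](setD1K iS) setUC avoidingU big_set1 -card_gt0 cardsD.
rewrite subn_gt0 setIC => le2.
rewrite ltnNge; apply/negP=> leA; have: 2 * #|av (S :\ i)| < M * #|av (S :\ i)| by rewrite ltn_mul2r av_gt0.
by rewrite ltnNge => /negP[]; apply: leq_trans le2; rewrite leq_mul2l leA orbT.
Qed.
End LopsidedLocalLemma.

(** * Hamilton cycles as cyclic lists of vertices *)

Section HamSeq.
Variable n : nat.
Implicit Types (pi : {perm 'I_n}) (s A B C : seq 'I_n) (e f : {set 'I_n}).

(** The cycle is cut open at an arbitrary vertex, so that a switching becomes a rearrangement of
    blocks of the list. *)
Definition ham_seq pi s := [/\ uniq s, size s = n & fcycle pi s].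

Lemma ham_seq_mem pi s x : ham_seq pi s -> x \in s.
Proof.
case=> Us szs _; suff: s =i predT by move->.
by apply/subset_cardP; [rewrite card_ord (card_uniqP Us) | apply/subsetP].
Qed.

Lemma ham_seq_next pi s x : ham_seq pi s -> pi x = next s x.
Proof. by move=> Hs; have [_ _ Cs] := Hs; apply/eqP/(next_cycle Cs (ham_seq_mem x Hs)). Qed.

Lemma ham_seq_inj pi1 pi2 s : ham_seq pi1 s -> ham_seq pi2 s -> pi1 = pi2.
Proof. by move=> H1 H2; apply/permP=> x; rewrite (ham_seq_next x H1) (ham_seq_next x H2). Qed.

Lemma ham_seq_traject pi x p : ham_seq pi (x :: p) -> x :: p = traject pi x n.
Proof.
case=> _ szp /=; rewrite rcons_path => /andP[/fpathP[k Ep] _].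
by move: szp; rewrite /= Ep size_traject => szp; rewrite -(congr1 (traject pi x) szp).
Qed.

Lemma ham_seq_ham pi s : 3 <= n -> ham_seq pi s -> dir_ham_cycle_on pi.
Proof.
move=> n3 Hs; split=> // x y; have [Us _ Cs] := Hs.
by rewrite (fconnect_cycle Cs (ham_seq_mem _ Hs)) (ham_seq_mem _ Hs).
Qed.

Lemma ham_order pi x : dir_ham_cycle_on pi -> fingraph.order pi x = n.
Proof.
case=> _ conn; rewrite -[RHS]card_ord.
by apply: eq_card => y; rewrite !inE; exact: conn.
Qed.

Lemma traject_ham_seq pi x : dir_ham_cycle_on pi -> ham_seq pi (traject pi x n).
Proof.
move=> Hpi; have ox := ham_order x Hpi.
have <- : orbit pi x = traject pi x n by rewrite /orbit ox.
split; [exact: orbit_uniq | by rewrite size_orbit |].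
by apply: cycle_orbit; exact: perm_inj.
Qed.

Lemma exists_ham_seq s : uniq s -> size s = n -> exists pi, ham_seq pi s.
Proof.
move=> Us szs; exists (perm (can_inj (prev_next Us))); split=> //.
by rewrite (eq_cycle (e' := frel (next s))) ?cycle_next // => x y; rewrite /= permE.
Qed.

Definition path_edges (x : 'I_n) (p : seq 'I_n) : seq {set 'I_n} :=
  pairmap (fun u v => [set u; v]) x p.

(** The path on the left is [rev (x :: p)]; edges are unordered pairs, so traversing a block
    backwards keeps them. *)
Lemma path_edges_rev x p :
  path_edges (last x p) (rev (belast x p)) =i path_edges x p.
Proof.
elim: p x => //= y p IHp x e; rewrite rev_cons -cats1 /path_edges pairmap_cat mem_cat.
rewrite -/(path_edges _ _) IHp /= !inE orbC; congr (_ || _).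
case: p {IHp} => [|z p] /=; first by rewrite setUC.
by rewrite rev_cons last_rcons setUC.
Qed.

Lemma path_edges_fpath pi x p : fpath pi x p ->
  path_edges x p = [seq [set z; pi z] | z <- belast x p].
Proof.
elim: p x => //= y p IHp x /andP[/eqP pix /IHp pathE].
by rewrite /path_edges /= -/(path_edges _ _) pathE pix.
Qed.

Lemma hedges_cycle pi x p : ham_seq pi (x :: p) -> hedges pi =i path_edges x (rcons p x).
Proof.
move=> Hs e; have [_ _ Cs] := Hs.
rewrite (path_edges_fpath Cs) belast_rcons.
apply/imsetP/mapP => -[z _ ->]; exists z => //; exact: (ham_seq_mem _ Hs).
Qed.

(** This separates the edges inside the blocks, which every switching keeps, from the three edges
    joining consecutive blocks, the only ones it can change. *)
Lemma hedges_blocks pi a A b B c C : ham_seq pi (a :: A ++ b :: B ++ c :: C) ->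
  hedges pi =i path_edges a A ++ path_edges b B ++ path_edges c C ++
    [:: [set last a A; b]; [set last b B; c]; [set last c C; a]].
Proof.
move=> /hedges_cycle He e; rewrite He.
rewrite -cats1 -!catA /path_edges pairmap_cat /= pairmap_cat /= pairmap_cat /=.
rewrite !(mem_cat, in_cons).
rewrite in_nil !orbF.
move: (e \in pairmap _ a A) (e \in pairmap _ b B) (e \in pairmap _ c C) => u v w.
by rewrite last_cat /=; case: u; case: v; case: w; rewrite ?orbT //=; do !case: eqP.
Qed.

Lemma hedges_blocks_rev pi a A b B c C : ham_seq pi (a :: A ++ b :: B ++ rev (c :: C)) ->
  hedges pi =i path_edges a A ++ path_edges b B ++ path_edges c C ++
    [:: [set last a A; b]; [set last b B; last c C]; [set c; a]].
Proof.
rewrite (lastI c C) rev_rcons => /hedges_blocks He e; rewrite He !mem_cat path_edges_rev.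
suff -> : last (last c C) (rev (belast c C)) = c by [].
by case: C {He} => //= y C; rewrite rev_cons last_rcons.
Qed.

End HamSeq.

(** Without repetitions, the last element of a prefix occurs only once, so its index gives the
    length of the prefix. *)
Lemma uniq_cat_split (T : eqType) (x : T) (P P' Q Q' : seq T) :
  uniq (x :: P ++ Q) -> P ++ Q = P' ++ Q' -> last x P = last x P' -> P = P' /\ Q = Q'.
Proof.
move=> U eqPQ eqlast.
have size_index (R S : seq T) : uniq (x :: R ++ S) -> index (last x R) (x :: R ++ S) = size R.
  move=> U'; have -> : last x R = nth x (x :: R ++ S) (size R).
    by rewrite -cat_cons nth_cat /= ltnS leqnn -last_nth.
  by rewrite index_uniq //= ltnS size_cat leq_addr.
have eqsz : size P = size P'.
  by rewrite -(size_index _ _ U) eqlast eqPQ size_index // -eqPQ.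
by move/eqP: eqPQ; rewrite eqseq_cat // => /andP[/eqP-> /eqP->].
Qed.

(** * Switchings and their effect on edges *)

Section Switchings.
Variable n : nat.
Implicit Types (G : {set {set 'I_n}}) (pi : {perm 'I_n}) (e f : {set 'I_n}) (i : 'I_2).

(* Cutting the cycle A B C at the edge e (between A and B) and at both ends of
   e' = last B - head A, the two switchings are the cycles B A C and B A C^rev.
   The triple in the second component of u, together with the new cycle,
   determines the old one. *)
Definition switched e (t : {perm 'I_n} * ({set 'I_n} * 'I_2))
    (u : {perm 'I_n} * ('I_n * 'I_n * 'I_2)) : Prop :=
  exists a A b B c C,
    [/\ ham_seq t.1 (a :: A ++ b :: B ++ c :: C),
        ham_seq u.1 (b :: B ++ a :: A ++ (if val t.2.2 == 0 then c :: C else rev (c :: C))),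
        e = [set last a A; b], t.2.1 = [set last b B; a] &
        u.2 = (last a A, last b B, t.2.2)].

(** The vertex [b] is the end of [e] other than the recorded [last a A], and the new cycle is listed
    from [b]. The recorded ends of [B] and [A] then locate the blocks, and the index tells whether
    to reverse the third one back. *)
Lemma switched_inj e t t' u : #|e| = 2 -> switched e t u -> switched e t' u -> t = t'.
Proof.
case: t t' u => [pi [e' i]] [rho [f' j]] [sig [[x x'] k]] e2.
case=> a [A [b [B [c [C [/= Hpi Hsig Ee -> [Ex Ex' Ei]]]]]]].
case=> a1 [A1 [b1 [B1 [c1 [C1 [/= Hrho Hsig1 Ee1 -> [Ex1 Ex1' Ei1]]]]]]].
rewrite -{j}Ei1 {k}Ei in Hsig1 *; rewrite Ex in Ex1; rewrite Ex' in Ex1'.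
have neq v w : e = [set v; w] -> v != w by move=> E; move: e2; rewrite E cards2; case: eqP.
have Eb : b = b1.
  have : b1 \in e by rewrite Ee1 !inE eqxx orbT.
  rewrite Ee !inE Ex1 => /orP[|] /eqP // E.
  by have := neq _ _ Ee1; rewrite -E eqxx.
rewrite -Eb in Hsig1 Hrho Ex1' Ee1.
have := ham_seq_traject Hsig; rewrite -(ham_seq_traject Hsig1) => -[Eseq].
have [Us _ _] := Hsig.
have [EB [Ea EAC]] := uniq_cat_split Us Eseq Ex1'.
rewrite -EB -Ea in Hrho Ex1.
have {}Us : uniq (a :: A ++ (if val i == 0 then c :: C else rev (c :: C))).
  by move: Us; rewrite -cat_cons cat_uniq => /and3P[].
have [EA EC] := uniq_cat_split Us EAC Ex1.
rewrite -EA in Hrho.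
have {}EC : c :: C = c1 :: C1.
  by move: EC; case: (val i == 0) => // /(congr1 rev); rewrite !revK.
by rewrite -EC in Hrho; rewrite (ham_seq_inj Hpi Hrho) EB Ea Eb.
Qed.

(** Of the three joining edges that may be lost, one is [e] and the other two contain an end of
    [e']. *)
Lemma switched_kept e pi e' i pi' w f : switched e (pi, (e', i)) (pi', w) ->
  f \in hedges pi -> f != e -> [disjoint f & e'] -> f \in hedges pi'.
Proof.
case=> a [A [b [B [c [C [/= Hpi Hpi' -> -> _]]]]]].
rewrite (hedges_blocks Hpi) => fpi /negPf fe dis.
have na : a \notin f by apply/negP => af; move: (disjointFr dis af); rewrite !inE eqxx orbT.
have nb : last b B \notin f by apply/negP => bf; move: (disjointFr dis bf); rewrite !inE eqxx.
have {fpi} : [|| f \in path_edges a A, f \in path_edges b B | f \in path_edges c C].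
  move: fpi; rewrite !mem_cat !in_cons in_nil fe /=.
  case/or4P=> [-> | -> | -> | /or3P[] // /eqP Ef]; rewrite ?orbT //.
    by rewrite Ef !inE eqxx in nb.
  by rewrite Ef !inE eqxx orbT in na.
move: Hpi'; case: (val i == 0) => [/hedges_blocks | /hedges_blocks_rev] ->;
  by rewrite !mem_cat => /or3P[] ->; rewrite ?orbT.
Qed.

(** One new joining edge is [e']; each of the other two contains [last a A] or [b], the ends of
    [e]. *)
Lemma switched_new e pi e' i pi' w f : switched e (pi, (e', i)) (pi', w) ->
  f \in hedges pi' -> [\/ f \in hedges pi, f = e' | ~~ [disjoint f & e]].
Proof.
case=> a [A [b [B [c [C [/= Hpi Hpi' -> -> _]]]]]] fpi'.
have ma y : ~~ [disjoint [set y; last a A] & [set last a A; b]].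
  by apply/pred0Pn; exists (last a A); rewrite /= !inE eqxx orbT.
have mb y : ~~ [disjoint [set y; b] & [set last a A; b]].
  by apply/pred0Pn; exists b; rewrite /= !inE eqxx !orbT.
have ma' y : ~~ [disjoint [set last a A; y] & [set last a A; b]] by rewrite setUC.
rewrite (hedges_blocks Hpi).
move: fpi' Hpi'; case: (val i == 0) => [fpi' /hedges_blocks E | fpi' /hedges_blocks_rev E];
  move: fpi'; rewrite {}E !mem_cat !in_cons in_nil;
  by case/or4P=> [-> | -> | -> | /or4P[] // /eqP ->]; rewrite ?orbT;
     first [by constructor 1 | by constructor 2 | by constructor 3].
Qed.

(** List the cycle from [y'] and cut it after [x] and after [x']: the blocks run from [y'] to [x],
    from [pi x] to [x'], and from [pi x'] to the predecessor of [y']. *)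
Lemma admissible_switched G pi x e' i : dir_ham_cycle G pi ->
  e' \notin hedges pi -> admissible G pi x e' i ->
  exists pi' w, [/\ dir_ham_cycle G pi', switched [set x; pi x] (pi, (e', i)) (pi', w),
    w.1.1 = x & w.2 = i].
Proof.
move=> [Hham piG] e'pi /existsP[x' /existsP[y' /and4P[/eqP Ee' neqx onp switchG]]].
have Hs := traject_ham_seq y' Hham; have [_ conn] := Hham.
have lt_k : findex pi y' x' < n.
  by rewrite -[X in _ < X](ham_order y' Hham) findex_max.
move: onp; rewrite /on_path; set k := findex pi y' x' => onp.
have Ek : iter k pi y' = x' by exact: iter_findex.
have Etr : traject pi y' n = traject pi y' k.+1 ++ traject pi (iter k.+1 pi y') (n - k.+1).
  by rewrite -trajectD subnKC.
have Elast : last y' (traject pi (pi y') k) = x' by rewrite last_traject.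
rewrite Etr {Etr} in Hs.
move: onp Hs Elast; rewrite trajectS.
move: (traject pi (pi y') k) (traject pi (iter k.+1 pi y') (n - k.+1)) => p q.
(* An empty second block would force [x = x'], which [admissible] excludes. *)
case/splitPl=> A p2; rewrite last_cat => Ex; case: p2 => [|b B] /=.
  by rewrite Ex => _ Exx'; rewrite Exx' eqxx in neqx.
rewrite -catA cat_cons => Hs Ex'.
(* With an empty third block [y'] would follow [x'], so [e'] would already lie on the cycle. *)
case: q => [|c C] in Hs *.
  case/negP: e'pi; rewrite Ee'; apply/imsetP; exists x' => //.
  case: Hs => _ _ /=; rewrite cats0 rcons_path => /andP[_ /eqP] /=.
  by rewrite last_cat /= Ex' => ->.
have [Us szs Cs] := Hs.
have pix : pi x = b.
  by move: Cs; rewrite /= rcons_path cat_path => /andP[/andP[_ /= /andP[/eqP <-]]]; rewrite Ex.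
have pix' : pi x' = c.
  move: Cs; rewrite /= rcons_path cat_path /= cat_path /=.
  by rewrite Ex' => /andP[/and4P[_ _ _ /andP[/eqP <-]]].
have piy' : (pi^-1)%g y' = last c C.
  move: Cs; rewrite /= rcons_path last_cat /= last_cat /= => /andP[_ /eqP <-].
  by rewrite permK.
pose D := if val i == 0 then c :: C else rev (c :: C).
have szD : size D = size (c :: C) by rewrite /D; case: ifP; rewrite ?size_rev.
have pD : perm_eq D (c :: C) by rewrite /D; case: ifP; rewrite ?perm_rev.
have pall : perm_eq (b :: B ++ y' :: A ++ D) (y' :: A ++ b :: B ++ c :: C).
  by have /seq.permP cD := pD; apply/seq.permP=> r; rewrite /= !count_cat /= !count_cat cD /=; lia.
have [pi' Hs'] : exists pi', ham_seq pi' (b :: B ++ y' :: A ++ D).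
  by apply: exists_ham_seq; rewrite ?(perm_uniq pall) ?(perm_size pall).
exists pi', (x, x', i); split=> //; last first.
  by exists y', A, b, B, c, C; split; rewrite //= ?pix ?Ex ?Ex' //.
split; first by apply: (ham_seq_ham _ Hs'); case: Hham.
apply/subsetP=> f fpi'.
have old : [|| f \in path_edges y' A, f \in path_edges b B | f \in path_edges c C] -> f \in G.
  move=> fold; apply: (subsetP piG); rewrite (hedges_blocks Hs) !mem_cat.
  by case/or3P: fold => ->; rewrite ?orbT.
suff new : [|| f \in path_edges y' A, f \in path_edges b B | f \in path_edges c C]
    \/ f \in switch pi i x x' y'.
  by case: new => [/old//|]; exact: (subsetP switchG).
move: Hs' fpi'; rewrite /D /switch /switch1 /switch2.
rewrite pix pix' piy'.
case: (val i == 0) => [/hedges_blocks -> | /hedges_blocks_rev ->];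
  rewrite !mem_cat !in_cons in_nil Ex Ex';
  case/or4P=> [-> | -> | -> | /or4P[] // /eqP ->]; rewrite ?orbT; auto; right;
  by rewrite !inE ?eqxx ?orbT // (setUC [set c] [set b]) eqxx ?orbT.
Qed.

End Switchings.

(** * Counting pairs and edges *)

Lemma card_dep_pairs (T U : finType) (E : {set T}) (F : T -> {set U}) :
  #|[set q : T * U | (q.1 \in E) && (q.2 \in F q.1)]| = \sum_(x in E) #|F x|.
Proof.
rewrite -sum1_card; under [RHS]eq_bigr do rewrite -sum1_card.
by rewrite pair_big_dep /=; apply: eq_bigl => q; rewrite inE.
Qed.

Section EdgeCounts.
Variables (n : nat) (G : {set {set 'I_n}}).
Hypothesis graphG : is_graph G.

Definition meeting (W : {set 'I_n}) := [set f in G | ~~ [disjoint f & W]].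

Lemma card_meeting W : #|meeting W| <= #|W| * n.
Proof.
apply: (@leq_trans #|[set [set z.1; z.2] | z in setX W [set: 'I_n]]|).
  apply/subset_leq_card/subsetP=> f; rewrite inE => /andP[/graphG/eqP/cards2P].
  case=> u [v [_ ->]] /pred0Pn[w /andP[/= /set2P[] -> wW]].
    by apply/imsetP; exists (u, v); rewrite // !inE wW.
  by apply/imsetP; exists (v, u); rewrite ?(setUC [set u]) // !inE wW.
by apply: leq_trans (leq_imset_card _ _) _; rewrite cardsX cardsT card_ord.
Qed.

Lemma card_cover_edges (Y : {set {set 'I_n}}) : Y \subset G -> #|cover Y| <= 2 * #|Y|.
Proof.
move=> YG; apply: leq_trans (leq_card_cover Y) _.
rewrite mulnC -sum_nat_const; apply: leq_sum => f fY.
by rewrite graphG ?(subsetP YG).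
Qed.

Lemma card_hedges (pi : {perm 'I_n}) : #|hedges pi| <= n.
Proof. by apply: leq_trans (leq_imset_card _ _) _; rewrite card_ord. Qed.

End EdgeCounts.

(** * The local lemma applied to random Hamilton cycles through [Z] *)

Section RainbowHamCycle.
Variables (n : nat) (G : {set {set 'I_n}}) (chi : {set 'I_n} -> nat) (Z : {set {set 'I_n}}).
Variables (m b : nat).
Hypothesis graphG : is_graph G.
Hypothesis bounded : forall c, #|colour_class G chi c| <= m.
Hypothesis ZG : Z \subset G.
Hypothesis Zuniq : forall f e, f \in Z -> e \in G -> chi e = chi f -> e = f.
Hypothesis ham_exists : exists pi, dir_ham_cycle G pi /\ Z \subset hedges pi.
Hypothesis many_switchings : forall pi, dir_ham_cycle G pi -> Z \subset hedges pi ->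
  forall x, [set x; pi x] \notin Z -> b <= n_admissible G pi x.

Let Om : {set {perm 'I_n}} :=
  [set pi : {perm 'I_n} | [&& 2 < n, [forall x, forall y, fconnect pi x y],
                 hedges pi \subset G & Z \subset hedges pi]].
Let J := [set p : {set 'I_n} * {set 'I_n} |
  [&& p.1 \in G, p.2 \in G, p.1 != p.2 & chi p.1 == chi p.2]].
Let A (p : {set 'I_n} * {set 'I_n}) :=
  [set pi : {perm 'I_n} | (p.1 \in hedges pi) && (p.2 \in hedges pi)].
Let N (p : {set 'I_n} * {set 'I_n}) :=
  [set q : {set 'I_n} * {set 'I_n} | ~~ [disjoint p.1 :|: p.2 & q.1 :|: q.2]].
Local Notation av := (avoiding A Om).
(** A lower bound for the number of usable switchings. The protected edges, [Z] and at most one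
    more, cover at most [2 * #|Z|.+1] vertices, and at most [n * m] edges repeat a colour of the
    cycle; both losses double because of the index in ['I_2]. *)
Let D := b - (4 * #|Z|.+1 * n + 2 * (n * m)).

Lemma OmP pi : reflect (dir_ham_cycle G pi /\ Z \subset hedges pi) (pi \in Om).
Proof.
rewrite inE; apply: (iffP and4P) => [[n3 conn piG Zpi] | [[[n3 conn] piG] Zpi]].
  by do !split=> //; move=> x y; have /forallP/(_ x)/forallP/(_ y) := conn.
by split=> //; apply/forallP=> x; apply/forallP.
Qed.

Lemma card_colour_hedges (pi : {perm 'I_n}) :
  #|[set f in G | [exists h in hedges pi, chi h == chi f]]| <= n * m.
Proof.
apply: (@leq_trans #|\bigcup_(h in hedges pi) colour_class G chi (chi h)|).
  apply/subset_leq_card/subsetP=> f; rewrite inE => /andP[fG /existsP[h /andP[hpi /eqP Ehf]]].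
  by apply/bigcupP; exists h => //; rewrite inE fG Ehf eqxx.
apply: leq_trans (card_bigcup _ _) _; apply: leq_trans (leq_sum _ (fun h _ => bounded (chi h))) _.
by rewrite sum_nat_const leq_mul2r card_hedges orbT.
Qed.

Let good (e : {set 'I_n}) (Y : {set {set 'I_n}}) (pi : {perm 'I_n}) :=
  [set p : {set 'I_n} * 'I_2 | [&& p.1 \in G, p.1 \notin hedges pi,
     [exists x, (e == [set x; pi x]) && admissible G pi x p.1 p.2],
     [disjoint p.1 & cover Y] & ~~ [exists h in hedges pi, chi h == chi p.1]]].

Lemma card_good e (Y : {set {set 'I_n}}) pi : Y \subset G -> #|Y| <= #|Z|.+1 -> pi \in Om ->
  e \in hedges pi -> e \notin Z -> D <= #|good e Y pi|.
Proof.
move=> YG cardY /OmP[Hpi Zpi] /imsetP[x _ Ee] eZ; rewrite /D leq_subLR.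
rewrite Ee in eZ; apply: leq_trans (many_switchings Hpi Zpi eZ) _; rewrite /n_admissible.
pose bad := meeting G (cover Y) :|: [set f in G | [exists h in hedges pi, chi h == chi f]].
apply: (@leq_trans #|setX bad [set: 'I_2] :|: good e Y pi|).
  apply/subset_leq_card/subsetP=> p; rewrite !inE => /and3P[-> -> adm] /=.
  case: [disjoint _ & _] => //=; case: [exists _ in _, _] => //=; rewrite !andbT.
  by apply/existsP; exists x; rewrite Ee eqxx.
apply: leq_trans (leq_card_setU _ _) _; rewrite leq_add2r cardsX cardsT card_ord.
have le1 := card_meeting graphG (cover Y).
have le2 := card_cover_edges graphG YG.
have le3 := card_colour_hedges pi.
have le4 : #|cover Y| * n <= 2 * #|Z|.+1 * n.
  by rewrite leq_mul2r (leq_trans le2) ?orbT // leq_mul2l cardY orbT.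
have : #|bad| <= _ := leq_card_setU _ _.
by lia.
Qed.

(** Double counting of good switchings away from [e]: every cycle through [e] and [Y] has at least
    [D], and every cycle is reached at most [4 * n] times. The result still avoids [S], as the edges
    of pairs in [S] do not touch [e] and the colour of [e'] is absent from the old cycle. *)
Lemma switching_step e (Y : {set {set 'I_n}}) (S : {set {set 'I_n} * {set 'I_n}}) : Z \subset Y -> Y \subset G -> #|Y| <= #|Z|.+1 ->
  e \in G -> e \notin Y -> S \subset J ->
  (forall q, q \in S -> [disjoint q.1 & e] /\ [disjoint q.2 & e]) ->
  D * #|[set pi in av S | (e \in hedges pi) && (Y \subset hedges pi)]|
    <= 4 * n * #|[set pi in av S | Y \subset hedges pi]|.
Proof.
move=> ZY YG cardY eG eY SJ disS; set X := [set _ in _ | _ && _]; set X' := [set _ in _ | _].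
have eZ : e \notin Z by apply: contra eY; exact: (subsetP ZY).
apply: (@leq_trans #|[set t : {perm 'I_n} * ({set 'I_n} * 'I_2)
                      | (t.1 \in X) && (t.2 \in good e Y t.1)]|).
  rewrite card_dep_pairs mulnC -sum_nat_const; apply: leq_sum => pi.
  by rewrite inE => /and3P[/avoidingP[piOm _] epi Ypi]; apply: card_good.
(* The recorded triple has 2 choices for the end of [e], [n] for the end of the second block and 2
   for the index. *)
have -> : 4 * n * #|X'| = #|setX X' (setX (setX e [set: 'I_n]) [set: 'I_2])|.
  by rewrite !cardsX !cardsT !card_ord graphG //; lia.
apply: (card_le_rel (R := switched e)); last first.
  by move=> t t' u; apply: switched_inj; exact: graphG.
case=> pi [e' i]; rewrite !inE /= => /andP[/andP[/andP[avpi piOm] /andP[epi Ypi]]].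
have {avpi piOm} : pi \in av S by rewrite !inE avpi piOm.
case/avoidingP=> /OmP[Hpi Zpi] Spi.
case/and5P=> e'G e'pi /existsP[x /andP[/eqP Ee adm]] disY newcol.
have [pi' [[[y z] j] [Hpi' sw /= Ey _]]] := admissible_switched Hpi e'pi adm; rewrite -Ee {y}Ey in sw.
exists (pi', (x, z, j)) => //.
have Ypi' : Y \subset hedges pi'.
  apply/subsetP=> f fY; apply: (switched_kept sw); first exact: (subsetP Ypi).
    by apply: contraNneq eY => <-.
  by rewrite disjoint_sym (disjointWr _ disY) // (bigcup_sup f).
have xe : x \in e by rewrite Ee !inE eqxx.
rewrite !in_setX !in_setT xe !andbT inE Ypi' andbT.
apply/avoidingP; split; first by apply/OmP; split=> //; apply: subset_trans ZY Ypi'.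
move=> q qS; rewrite inE; apply/andP=> -[q1 q2].
have := subsetP SJ q qS; rewrite inE => /and4P[q1G q2G neq /eqP eqchi].
have [dis1 dis2] := disS q qS.
have new h f : h \in hedges pi -> f = e' -> chi h = chi f -> False.
  move=> hpi Ef Ec; case/negP: newcol; apply/existsP; exists h.
  by rewrite hpi Ec Ef eqxx.
(* Both edges old: the old cycle failed to avoid [q]. One old, one new: [e'] repeats a colour. Both
   new: both equal [e'], but the pair is distinct. *)
case: (switched_new sw q1) => [q1pi | Eq1 | /negP//];
  case: (switched_new sw q2) => [q2pi | Eq2 | /negP//].
- by have := Spi q qS; rewrite inE q1pi q2pi.
- exact: (new _ _ q1pi Eq2).
- exact: (new _ _ q2pi Eq1).
- by rewrite Eq1 Eq2 eqxx in neq.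
Qed.

(** At most [4 * n] edges touch the pair, each with at most [m] edges of its colour; the factor 2
    covers which entry of the conflicting pair touches. *)
Lemma card_conflicts p : p \in J -> #|J :&: N p| <= 8 * n * m.
Proof.
rewrite inE => /and4P[p1G p2G _ _]; pose E := meeting G (p.1 :|: p.2).
have cE : #|E| <= 4 * n.
  apply: leq_trans (card_meeting graphG _) _; rewrite leq_mul2r (leq_trans (leq_card_setU _ _)) ?orbT //.
  by rewrite !graphG.
pose P := [set q : {set 'I_n} * {set 'I_n} |
             (q.1 \in E) && (q.2 \in colour_class G chi (chi q.1))].
have cP : #|P| <= 4 * n * m.
  rewrite (card_dep_pairs E (fun f => colour_class G chi (chi f))).
  apply: leq_trans (leq_sum _ (fun f _ => bounded (chi f))) _.
  by rewrite sum_nat_const leq_mul2r cE orbT.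
pose sw (q : {set 'I_n} * {set 'I_n}) := (q.2, q.1).
apply: (@leq_trans #|P :|: sw @: P|).
  apply/subset_leq_card/subsetP=> -[f g]; rewrite in_setI !(inE, in_setU) /=.
  case/andP=> /and4P[fG gG _ /eqP Ec]; rewrite fG gG Ec eqxx andbT /=.
  rewrite disjoint_sym disjoints_subset subUset -!disjoints_subset negb_and => /orP[->//|gp].
  apply/orP; right; apply/imsetP; exists (g, f) => //.
  by rewrite !inE /= gG fG gp Ec eqxx.
apply: leq_trans (leq_card_setU _ _) _.
by have := leq_imset_card sw P; lia.
Qed.

Lemma rainbow_ham_cycle : 16 * (n * n) * (32 * n * m + 3) <= D * D ->
  exists pi, dir_ham_cycle G pi /\ Z \subset hedges pi /\ rainbow chi (hedges pi).
Proof.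
move=> largeD.
have [pi0 pi0P] := ham_exists.
have n_gt0 : 0 < n by case: pi0P => [[[n3 _] _] _]; apply: leq_trans n3.
suff: exists2 pi, pi \in Om & forall p, p \in J -> pi \notin A p.
  case=> pi /OmP[Hpi Zpi] Api; exists pi; split=> //; split=> // e f epi fpi Ec; apply/eqP; apply: contraT => neq.
  have piG := subsetP (proj2 Hpi).
  by have := Api (e, f); rewrite !inE /= epi fpi !piG // neq Ec eqxx => /(_ isT).
(* Here [M] is [4 * d + 3]; the 3 secures [2 < M] even when [m] is zero. *)
apply: (lopsided_local_lemma (N := N) (M := 32 * n * m + 3) (d := 8 * n * m)).
- exact: card_conflicts.
- by lia.
- move=> p S pJ SJ disN; have := pJ; rewrite inE => /and4P[p1G p2G neq /eqP Ec].
  (* Colours on [Z] are unique in [G], so neither edge of a bad pair is in [Z] and both may be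
     switched away. *)
  have p1Z : p.1 \notin Z by apply: contra neq => /Zuniq-/(_ _ p2G)->.
  have p2Z : p.2 \notin Z by apply: contra neq => /Zuniq-/(_ _ p1G)->.
  have disS q : q \in S -> [disjoint p.1 :|: p.2 & q.1 :|: q.2].
    by move=> qS; have := disjointFr disN qS; rewrite inE => /negbFE.
  (* First [p.1] is switched away while [p.2] and [Z] are protected, then [p.2] while [Z] is
     protected. Each step gains a factor [4 * n / D]. *)
  have step2 := @switching_step p.2 Z S (subxx _) ZG (leqnSn _) p2G p2Z SJ.
  have step1 := @switching_step p.1 (p.2 |: Z) S (subsetUr _ _).
  have {}step1 := step1 _ _ p1G _ SJ _.
  have {}step1 : D * #|A p :&: av S| <= 4 * n * #|[set pi in av S | p.2 |: Z \subset hedges pi]|.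
    apply: leq_trans (step1 _ _ _ _).
    + rewrite leq_mul2l subset_leq_card ?orbT //; apply/subsetP=> pi.
      rewrite in_setI [pi \in A p]inE => /andP[/andP[p1pi p2pi] avpi].
      rewrite inE avpi p1pi subUset sub1set p2pi /=.
      by case/avoidingP: avpi => /OmP[].
    + by rewrite subUset sub1set p2G.
    + by rewrite cardsU1 p2Z.
    + by rewrite !inE negb_or neq.
    + move=> q /disS; rewrite disjoint_sym => dis.
      by split; apply: disjointW dis; rewrite ?subsetUl ?subsetUr.
  have {}step2 : D * #|[set pi in av S | p.2 |: Z \subset hedges pi]| <= 4 * n * #|av S|.
    apply: (@leq_trans (4 * n * #|[set pi in av S | Z \subset hedges pi]|)); last first.
      by rewrite leq_mul2l subset_leq_card ?orbT //; apply/subsetP=> pi; rewrite inE => /andP[].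
    apply: leq_trans (step2 _).
      rewrite leq_mul2l subset_leq_card ?orbT //; apply/subsetP=> pi.
      by rewrite !inE subUset sub1set.
    move=> q /disS; rewrite disjoint_sym => dis.
    by split; apply: disjointW dis; rewrite ?subsetUl ?subsetUr.
  move: step1 step2; set u := #|A p :&: _|; set v := #|[set _ in _ | _]|; set w := #|av S|.
  move=> step1 step2.
  have nn : 0 < 16 * (n * n) by rewrite !muln_gt0 n_gt0.
  rewrite -(leq_pmul2l nn) mulnA.
  apply: (@leq_trans (D * D * u)); first by rewrite leq_mul2r largeD orbT.
  have := leq_mul (leqnn D) step1; have := leq_mul (leqnn (4 * n)) step2.
  by lia.
- by lia.
- by apply/set0Pn; exists pi0; apply/OmP.
Qed.

End RainbowHamCycle.

(** * Choice of the real constants *)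

Open Scope R_scope.

Lemma nat_floor (r : R) : 0 <= r -> exists k : nat, INR k <= r < INR k + 1.
Proof.
move=> r0; have [le_r lt_r] := base_Int_part r.
have z0 : (0 <= Int_part r)%Z.
  by have : (-1 < Int_part r)%Z; [apply: lt_IZR; lra | lia].
have [k Ek] := IZN _ z0; exists k; rewrite INR_IZR_INZ -Ek; lra.
Qed.

Lemma leq_INR (k l : nat) : INR k <= INR l -> leq k l.
Proof. by move=> /INR_le/ssrnat.leP. Qed.

Theorem mainTheorem4 :
  forall beta : R, 0 < beta <= 1 ->
  exists alpha0 : R, 0 < alpha0 /\
  forall alpha : R, 0 < alpha <= alpha0 ->
  exists mu0 : R, 0 < mu0 /\ exists n0 : nat,
  forall mu : R, 0 < mu <= mu0 ->
  forall n : nat, leq n0 n ->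
  forall (G : {set {set 'I_n}}) (chi : {set 'I_n} -> nat) (Z : {set {set 'I_n}}),
    is_graph G ->
    (* chi is a (mu n)-bounded colouring of E(G) *)
    (forall c : nat, INR #|colour_class G chi c| <= mu * INR n) ->
    Z \subset G ->
    INR #|Z| <= alpha * INR n ->
    (forall f e, f \in Z -> e \in G -> chi e = chi f -> e = f) ->
    (exists pi : {perm 'I_n}, dir_ham_cycle G pi /\ Z \subset hedges pi) ->
    (forall pi : {perm 'I_n}, dir_ham_cycle G pi -> Z \subset hedges pi ->
       forall x : 'I_n, [set x; pi x] \notin Z ->
       beta * (INR n) ^ 2 <= INR (n_admissible G pi x)) ->
    exists pi : {perm 'I_n},
      dir_ham_cycle G pi /\ Z \subset hedges pi /\ rainbow chi (hedges pi).
Proof.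
move=> beta [beta0 beta1]; exists (beta / 32); split; first by lra.
move=> alpha [alpha_gt0 le_alpha]; exists (beta * beta / 4096); split; first by nra.
(* The threshold [k.+1] exceeds 32 / beta, which gives [32 <= beta * INR n]. *)
have [k [_ lt_k]] : exists k : nat, INR k <= 32 / beta < INR k + 1.
  by apply: nat_floor; apply: Rlt_le; apply: Rdiv_lt_0_compat; lra.
exists k.+1 => mu [mu0 le_mu] n le_n G chi Z graphG bounded ZG cardZ Zuniq ham_ex many.
have {lt_k le_n} beta_n : 32 <= beta * INR n.
  have le_kn : INR k + 1 <= INR n by rewrite -S_INR; apply: le_INR; apply/ssrnat.leP.
  have : 32 / beta * beta <= INR n * beta by apply: Rmult_le_compat_r; lra.
  by rewrite /Rdiv Rmult_assoc Rinv_l; lra.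
have [x Ex] : exists x, x = INR n by exists (INR n).
rewrite -Ex in beta_n cardZ bounded many.
have x1 : 1 <= x by nra.
(* Both bounds concern integers, so their floors [m] and [b] can replace them. *)
have [m [le_m lt_m]] : exists m : nat, INR m <= mu * x < INR m + 1 by apply: nat_floor; nra.
have [b [le_b lt_b]] : exists b : nat, INR b <= beta * x ^ 2 < INR b + 1.
  by apply: nat_floor; nra.
apply: (@rainbow_ham_cycle n G chi Z m b) => //.
- move=> c; rewrite -ltnS; apply/ssrnat.ltP/INR_lt; rewrite S_INR.
  by apply: Rle_lt_trans lt_m.
- by move=> pi Hpi Zpi y /(many pi Hpi Zpi) le_adm; apply: leq_INR; lra.
have cardZ0 : 0 <= INR #|Z| by exact: pos_INR.
set s := (4 * _ * _ + _)%nat.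
have Es : INR s = 4 * (INR #|Z| + 1) * x + 2 * (x * INR m).
  by rewrite /s plus_INR !mult_INR !S_INR -Ex /=; ring.
have [q Eq] : exists q, q = beta * x ^ 2 by exists (beta * x ^ 2).
rewrite -Eq in le_b lt_b.
have q32x : 32 * x <= q by rewrite Eq; nra.
have le_Zx : INR #|Z| * x <= q / 32.
  apply: (@Rle_trans _ (alpha * x * x)); first by apply: Rmult_le_compat_r; lra.
  by rewrite Eq; have : alpha * x ^ 2 <= beta / 32 * x ^ 2; [apply: Rmult_le_compat_r; nra | lra].
have le_xm : x * INR m <= beta * q / 4096.
  apply: (@Rle_trans _ (x * (mu * x))); first by apply: Rmult_le_compat_l; lra.
  rewrite Eq; have : mu * x ^ 2 <= beta * beta / 4096 * x ^ 2 by apply: Rmult_le_compat_r; nra.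
  by lra.
have le_bq : beta * q <= q by nra.
(* The three losses are at most q/8 from [Z], q/8 from the linear term and q/2048 from colours; the
   spare 1 absorbs the rounding of [b]. *)
have le_s : INR s <= q * (7 / 16) - 1 by rewrite Es; lra.
have le_D : q / 2 <= INR (b - s)%nat.
  have le_sb : leq s b by apply: leq_INR; lra.
  by rewrite minus_INR; [lra | apply/ssrnat.leP].
apply: leq_INR.
have -> : INR (16 * (n * n) * (32 * n * m + 3))%nat = 16 * (x * x) * (32 * (x * INR m) + 3).
  by rewrite !mult_INR plus_INR !mult_INR !S_INR -Ex /=; ring.
rewrite mult_INR; apply: (@Rle_trans _ (q / 2 * (q / 2))); last first.
  by apply: Rmult_le_compat => //; lra.
(* The left side is at most 512 q^2/4096 + 48 q^2/1024, which is below q^2/4. *)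
have : x * x * (x * INR m) <= x * x * (beta * q / 4096) by apply: Rmult_le_compat_l; nra.
have -> : x * x * (beta * q / 4096) = q * q / 4096 by rewrite Eq; field.
have : (32 * x) * (32 * x) <= q * q by apply: Rmult_le_compat; lra.
by have := Rle_0_sqr x; rewrite /Rsqr; lra.
Qed.
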